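(* Let $(G,\mathsf D_G)$ be a Dirac Lie group. The associated codistribution $\mathsf{P_1}$ (respectively distribution $\mathsf{G_0}$) has constant rank on $G$, and is given by $\mathsf{P_1}=\mathfrak p_1^L=\mathfrak p_1^R$ (respectively $\mathsf{G_0}=\mathfrak g_0^L=\mathfrak g_0^R$).
   Context: A Dirac structure on a manifold $M$ is a vector subbundle $\mathsf D\subseteq TM\oplus T^*M$ equal to its own orthogonal for the fiberwise pairing $\langle(u,\alpha),(v,\beta)\rangle=\beta(u)+\alpha(v)$. Let $G$ be a Lie group with Lie algebra $\mathfrak g=T_eG$ and left/right multiplications $L_g,R_g$. $(G,\mathsf D_G)$ is a Dirac Lie group if $\mathsf D_G$ is a Dirac structure on $G$ (not necessarily integrable) which is multiplicative: multiplication $(G\times G,\mathsf D_G\oplus\mathsf D_G)\to(G,\mathsf D_G)$ is a forward Dirac map; explicitly, for all $g,h\in G$ and $(v,\alpha)\in\mathsf D_G(gh)$ there are $w\in T_gG$, $u\in T_hG$ with $(w,(T_gR_h)^*\alpha)\in\mathsf D_G(g)$, $(u,(T_hL_g)^*\alpha)\in\mathsf D_G(h)$ and $v=T_gR_hw+T_hL_gu$. For $g\in G$: $\mathsf{G_0}(g)=\{v\in T_gG\mid(v,0)\in\mathsf D_G(g)\}$ and $\mathsf{P_1}(g)=\{\alpha\in T_g^*G\mid\exists v\in T_gG:(v,\alpha)\in\mathsf D_G(g)\}$; $\mathfrak g_0=\mathsf{G_0}(e)$, $\mathfrak p_1=\mathsf{P_1}(e)$. Moreover $\mathfrak g_0^L(g)=T_eL_g\mathfrak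 g_0$, $\mathfrak g_0^R(g)=T_eR_g\mathfrak g_0$, $\mathfrak p_1^L(g)=(T_gL_{g^{-1}})^*\mathfrak p_1$, $\mathfrak p_1^R(g)=(T_gR_{g^{-1}})^*\mathfrak p_1$. *)

(* Defs.v *)
From HB Require Import structures.
From mathcomp Require Import all_boot all_order all_algebra.
From mathcomp Require Import all_classical all_reals all_analysis.
Import Order.TTheory GRing.Theory Num.Theory numFieldNormedType.Exports.

Set Implicit Arguments.
Unset Strict Implicit.
Unset Printing Implicit Defensive.

Local Open Scope classical_set_scope.
Local Open Scope ring_scope.

(* C^k and C^oo maps on an open set U of a finite-dimensional space V; the     *)
(* values of f outside U are irrelevant.                                      *)
Fixpoint Ck_on (R : realType) (V W : normedModType R) (k : nat) (U : set V)
    (f : V -> W) : Prop :=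
  if k is k'.+1 then
    (forall x, U x -> differentiable f x) /\
    (forall v, Ck_on k' U (fun x => 'D_v f x))
  else forall x, U x -> {for x, continuous f}.

Definition smooth_on (R : realType) (V W : normedModType R) (U : set V)
  (f : V -> W) : Prop := forall k, Ck_on k U f.

(* A chart is a homeomorphism from an open set of M onto an open set of R^n.  *)
(* The map and its inverse are total functions, meaningful only on chart_dom  *)
(* and on its image.                                                          *)
Record chart (R : realType) (n : nat) (M : topologicalType) := Chart {
  chart_dom : set M ;
  chart_map :> M -> 'rV[R]_n ;
  chart_inv : 'rV[R]_n -> M ;
  chart_dom_open : open chart_dom ;
  chart_cod_open : open (chart_map @` chart_dom) ;
  chart_mapK : forall p, chart_dom p -> chart_inv (chart_map p) = p ;
  chart_map_continuous :
    forall p, chart_dom p -> {for p, continuous chart_map} ;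
  chart_inv_continuous :
    forall x, (chart_map @` chart_dom) x -> {for x, continuous chart_inv} }.

Definition chart_cod (R : realType) (n : nat) (M : topologicalType)
  (c : chart R n M) : set 'rV[R]_n := c @` chart_dom c.

HB.mixin Record isSmoothManifold (R : realType) (n : nat) M of Topological M :=
  { atlas : set (chart R n M) ;
    atlas_cover : forall p : M, exists2 c, atlas c & chart_dom c p ;
    atlas_compatible : forall a b, atlas a -> atlas b ->
      smooth_on [set x | chart_cod a x /\ chart_dom b (chart_inv a x)]
        (fun x => b (chart_inv a x)) ;
    manifold_hausdorff : hausdorff_space M ;
    manifold_second_countable : @second_countable M }.

#[short(type="smoothManifoldType")]
HB.structure Definition SmoothManifold (R : realType) (n : nat) :=
  { M of isSmoothManifold R n M & Topological M }.

Definition smooth_map (R : realType) (m n : nat) (M : smoothManifoldType R m)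
    (N : smoothManifoldType R n) (f : M -> N) : Prop :=
  continuous f /\
  forall (a : chart R m M) (b : chart R n N), atlas a -> atlas b ->
    smooth_on [set x | chart_cod a x /\ chart_dom b (f (chart_inv a x))]
      (fun x => b (f (chart_inv a x))).

(* Smoothness of the multiplication is expressed in the product charts of     *)
(* G x G.                                                                     *)
HB.mixin Record isLieGroup (R : realType) (n : nat) G
    of SmoothManifold R n G & Group G :=
  { lie_mul_continuous : continuous (fun z : G * G => (z.1 * z.2)%g) ;
    lie_mul_smooth : forall a b c : chart R n G,
      atlas a -> atlas b -> atlas c ->
      smooth_on
        [set z : 'rV[R]_n * 'rV[R]_n |
          [/\ chart_cod a z.1, chart_cod b z.2
            & chart_dom c (chart_inv a z.1 * chart_inv b z.2)%g]]
        (fun z => c (chart_inv a z.1 * chart_inv b z.2)%g) ;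
    lie_inv_smooth : smooth_map (fun g : G => (g^-1)%g) }.

#[short(type="lieGroupType")]
HB.structure Definition LieGroup (R : realType) (n : nat) :=
  { G of isLieGroup R n G & SmoothManifold R n G & Group G }.

Section Bundles.
Context (R : realType) (n : nat) (M : smoothManifoldType R n).
Implicit Types p q : M.

Definition chart_at p : chart R n M := s2val (cid2 (atlas_cover p)).

Lemma chart_at_atlas p : atlas (chart_at p).
Proof. exact: s2valP (cid2 (atlas_cover p)). Qed.

Lemma chart_at_dom p : chart_dom (chart_at p) p.
Proof. exact: s2valP' (cid2 (atlas_cover p)). Qed.

(* T_p M is R^n, its elements being the coordinates of tangent vectors in the *)
(* chart chart_at p; T*_p M is its dual.  As T_p M and T_q M have the same    *)
(* underlying space, no transport is needed between fibres over points that   *)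
(* are provably but not definitionally equal, such as g^-1 * g and 1.         *)
Definition tangent p : vectType R := 'rV[R]_n.
Definition cotangent p : vectType R := 'Hom(tangent p, R^o).
Definition pontryagin p : vectType R := (tangent p * cotangent p)%type.

(* For p in the domain of c, these are the mutually inverse changes of        *)
(* coordinates between chart_at p and c.                                      *)
Definition to_coord (c : chart R n M) p : 'Hom(tangent p, 'rV[R]_n) :=
  linfun ('d (c \o chart_inv (chart_at p)) (chart_at p p)).
Definition of_coord (c : chart R n M) p : 'Hom('rV[R]_n, tangent p) :=
  linfun ('d (chart_at p \o chart_inv c) (c p)).

Definition smooth_vector_field (U : set M) (X : forall p, tangent p) : Prop :=
  forall c : chart R n M, atlas c ->
    smooth_on (c @` (U `&` chart_dom c))
      (fun x => to_coord c (chart_inv c x) (X (chart_inv c x))).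

Definition smooth_one_form (U : set M) (a : forall p, cotangent p) : Prop :=
  forall c : chart R n M, atlas c -> forall v : 'rV[R]_n,
    smooth_on (c @` (U `&` chart_dom c))
      (fun x => a (chart_inv c x) (of_coord c (chart_inv c x) v) : R).

Definition smooth_subbundle (D : forall p, {vspace pontryagin p}) : Prop :=
  forall p, exists (U : set M) (k : nat) (s : 'I_k -> forall q, pontryagin q),
    [/\ open_nbhs p U,
        forall i, smooth_vector_field U (fun q => (s i q).1),
        forall i, smooth_one_form U (fun q => (s i q).2)
      & forall q, U q -> basis_of (D q) [tuple s i q | i < k]].

Definition pairing p (x y : pontryagin p) : R := y.2 x.1 + x.2 y.1.

Definition dirac_structure (D : forall p, {vspace pontryagin p}) : Prop :=
  smooth_subbundle D /\
  forall p (x : pontryagin p),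
    x \in D p <-> (forall y, y \in D p -> pairing x y = 0).

Section Distributions.
Variable D : forall p, {vspace pontryagin p}.

Definition G0 p : {vspace tangent p} :=
  (linfun (fun v : tangent p => (v, 0) : pontryagin p) @^-1: D p)%VS.

Definition P1 p : {vspace cotangent p} :=
  (linfun (fun x : pontryagin p => x.2) @: D p)%VS.

Lemma mem_G0 p (v : tangent p) : (v \in G0 p) = (((v, 0) : pontryagin p) \in D p).
Proof.
have lin : linear (fun v : tangent p => (v, 0) : pontryagin p).
  by move=> a u w; apply/pair_equal_spec; split; rewrite //= scaler0 addr0.
pose B := GRing.isLinear.Build _ _ _ _ _ lin.
pose f : {linear tangent p -> pontryagin p} :=
  HB.pack (fun v : tangent p => (v, 0) : pontryagin p) B.
by rewrite -memv_preim (lfunE f).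
Qed.

Lemma mem_P1 p (a : cotangent p) :
  a \in P1 p <-> exists v : tangent p, ((v, a) : pontryagin p) \in D p.
Proof.
have lin : linear (fun x : pontryagin p => x.2) by [].
pose B := GRing.isLinear.Build _ _ _ _ _ lin.
pose f : {linear pontryagin p -> cotangent p} :=
  HB.pack (fun x : pontryagin p => x.2) B.
split=> [/memv_imgP[[v b] Dvb]|[v Dva]].
  by rewrite (lfunE f) /= => ->; exists v.
by apply/memv_imgP; exists (v, a) => //; rewrite (lfunE f).
Qed.

End Distributions.

End Bundles.

Section TangentMap.
Context (R : realType) (m n : nat).
Context (M : smoothManifoldType R m) (N : smoothManifoldType R n).

Definition tangent_map (f : M -> N) (p : M) :
    'Hom(tangent p, tangent (f p)) :=
  linfun ('d (chart_at (f p) \o f \o chart_inv (chart_at p)) (chart_at p p)).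

Definition cotangent_map (f : M -> N) (p : M) :
    'Hom(cotangent (f p), cotangent p) :=
  linfun (fun a : cotangent (f p) => (a \o tangent_map f p)%VF : cotangent p).

Lemma cotangent_mapE f p (a : cotangent (f p)) :
  cotangent_map f p a = (a \o tangent_map f p)%VF.
Proof.
have lin : linear
    (fun a : cotangent (f p) => (a \o tangent_map f p)%VF : cotangent p).
  by move=> k u w; rewrite comp_lfunDl comp_lfunZl.
pose B := GRing.isLinear.Build _ _ _ _ _ lin.
pose h : {linear cotangent (f p) -> cotangent p} := HB.pack
  (fun a : cotangent (f p) => (a \o tangent_map f p)%VF : cotangent p) B.
exact: (lfunE h).
Qed.

End TangentMap.

Section DiracLieGroup.
Context (R : realType) (n : nat) (G : lieGroupType R n).

Definition ltrans (g : G) : G -> G := fun h => (g * h)%g.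
Definition rtrans (h : G) : G -> G := fun g => (g * h)%g.

Definition multiplicative (D : forall g : G, {vspace pontryagin g}) : Prop :=
  forall (g h : G) (v : tangent (g * h)%g) (a : cotangent (g * h)%g),
    ((v, a) : pontryagin (g * h)%g) \in D (g * h)%g ->
    exists (w : tangent g) (u : tangent h),
      [/\ ((w, cotangent_map (rtrans h) g a) : pontryagin g) \in D g,
          ((u, cotangent_map (ltrans g) h a) : pontryagin h) \in D h
        & v = tangent_map (rtrans h) g w + tangent_map (ltrans g) h u].

Definition dirac_lie_group (D : forall g : G, {vspace pontryagin g}) : Prop :=
  dirac_structure D /\ multiplicative D.

Definition left_distribution (V : {vspace tangent (1%g : G)}) (g : G) :
    {vspace tangent g} := (tangent_map (ltrans g) 1%g @: V)%VS.

Definition right_distribution (V : {vspace tangent (1%g : G)}) (g : G) :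
    {vspace tangent g} := (tangent_map (rtrans g) 1%g @: V)%VS.

Definition left_codistribution (W : {vspace cotangent (1%g : G)}) (g : G) :
    {vspace cotangent g} := (cotangent_map (ltrans g^-1%g) g @: W)%VS.

Definition right_codistribution (W : {vspace cotangent (1%g : G)}) (g : G) :
    {vspace cotangent g} := (cotangent_map (rtrans g^-1%g) g @: W)%VS.

End DiracLieGroup.

Definition constant_rank (R : realType) (n : nat) (M : smoothManifoldType R n)
    (E : M -> vectType R) (V : forall p : M, {vspace E p}) : Prop :=
  exists k : nat, forall p : M, \dim (V p) = k.

(* Main.v *)
Require Import Defs.
From mathcomp Require Import all_boot all_order all_algebra.
From mathcomp Require Import all_classical all_reals all_analysis.
Import Order.TTheory GRing.Theory Num.Theory numFieldNormedType.Exports.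

(** Multiplicativity, read only on its covector components, says that the
    pullbacks of a covector of [P1 D (g * h)] by the two translations lie in
    [P1 D g] and [P1 D h] ([P1_mul]).  Taking the second factor of the product
    to be 1 shows that the pullback by [ltrans g] maps [P1 D g] into [P1 D 1];
    writing 1 as [g^-1 * g] shows that the pullback by [ltrans g^-1] maps
    [P1 D 1] into [P1 D g].  These two pullbacks are inverse to each other, so
    both inclusions are equalities and [P1] is left invariant, hence of
    constant rank.  The right-handed case is the same with the factors
    exchanged.

    Since [D g] is its own orthogonal, [G0 D g] is the annihilator of [P1 D g]
    ([G0_annihilator]), so the invariance of [G0] follows from that of [P1] by
    duality.  This part is linear algebra, done for both sides at once in
    [dual_transport].

    The differential geometry needed is that the tangent maps of the
    translations by [g] and [g^-1] are inverse to each other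
    ([tangent_ltransK], [tangent_rtransK]).  It is the chain rule in the
    preferred charts: a translation is smooth because it is the multiplication
    with one argument frozen, and its coordinate expression composed with that
    of the inverse translation is the identity near the point. *)

Set Implicit Arguments.
Unset Strict Implicit.
Unset Printing Implicit Defensive.

Local Open Scope classical_set_scope.
Local Open Scope ring_scope.

(** * Tangent maps of mutually inverse maps *)

Section CoordinateExpression.
Context (R : realType) (n : nat).

Definition coord_expr (M N : smoothManifoldType R n) (f : M -> N) (p : M) :
    'rV[R]_n -> 'rV[R]_n :=
  chart_at (f p) \o f \o chart_inv (chart_at p).

Lemma tangent_mapE (M N : smoothManifoldType R n) (f : M -> N) (p : M)
    (v : tangent p) :
  tangent_map f p v = 'd (coord_expr f p) (chart_at p p) v.
Proof. by rewrite /tangent_map lfunE. Qed.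

Lemma near_chart_inv (M : smoothManifoldType R n) (p : M) (A : set M) :
  nbhs p A -> \forall x \near chart_at p p, A (chart_inv (chart_at p) x).
Proof.
have dp := chart_at_dom p => nA.
apply: (chart_inv_continuous (c := chart_at p) (x := chart_at p p)).
  by exists p.
by rewrite chart_mapK.
Qed.

(** Agreement with the identity is only asked near [x], as coordinate
    expressions are meaningful only on the codomain of a chart; a differential
    is determined by the germ of the map. *)
Lemma diff_near_id (F : 'rV[R]_n -> 'rV[R]_n) (x : 'rV[R]_n) :
  differentiable F x -> (\forall y \near x, F y = y) ->
  forall v, 'd F x v = v.
Proof.
move=> dF nF v; rewrite -(deriveE v dF).
have -> : 'D_v F x = 'D_v (@id 'rV[R]_n) x by exact: near_eq_derive.
exact: derive_id.
Qed.

(** The chain rule in the preferred charts at [p], [f p] and [g (f p)].  Both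
    sides are read in ['rV[R]_n] because [tangent (g (f p))] and [tangent p]
    are fibres over points that are only provably equal. *)
Lemma tangent_mapK (M N : smoothManifoldType R n) (f : M -> N) (g : N -> M) p :
  cancel f g -> {for p, continuous f} ->
  differentiable (coord_expr f p) (chart_at p p) ->
  differentiable (coord_expr g (f p)) (chart_at (f p) (f p)) ->
  forall v : 'rV[R]_n, tangent_map g (f p) (tangent_map f p v) = v.
Proof.
move=> fK fc df dg v; have dp := chart_at_dom p.
have fE : coord_expr f p (chart_at p p) = chart_at (f p) (f p).
  by rewrite /coord_expr /= chart_mapK.
have dg' : differentiable (coord_expr g (f p)) (coord_expr f p (chart_at p p)).
  by rewrite fE.
suff nid : \forall x \near chart_at p p,
    (coord_expr g (f p) \o coord_expr f p) x = x.
  have := diff_near_id (differentiable_comp df dg') nid v.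
  rewrite (diff_comp df dg') fE => E; rewrite !tangent_mapE; exact: E.
(* The chart at [f p] cancels with its inverse only where [f] stays in its
   domain, which is where the continuity of [f] is used. *)
have nV : \forall x \near chart_at p p,
    chart_dom (chart_at (f p)) (f (chart_inv (chart_at p) x)).
  apply: (near_chart_inv (A := f @^-1` chart_dom (chart_at (f p)))).
  apply: fc; apply: open_nbhs_nbhs; split; first exact: chart_dom_open.
  exact: chart_at_dom.
have nU : \forall x \near chart_at p p, (chart_at p @` chart_dom (chart_at p)) x.
  apply: open_nbhs_nbhs; split; first exact: chart_cod_open.
  by exists p.
near=> x.
have Vx : chart_dom (chart_at (f p)) (f (chart_inv (chart_at p) x)) by near: x.
rewrite /coord_expr /= chart_mapK // !fK.
have [q dq <-] : (chart_at p @` chart_dom (chart_at p)) x by near: x.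
by rewrite chart_mapK.
Unshelve. all: by end_near.
Qed.

End CoordinateExpression.

(** * Translations of a Lie group *)

Section Translations.
Context (R : realType) (n : nat) (G : lieGroupType R n).
Implicit Types g h k : G.

Lemma ltransK g : cancel (ltrans g) (ltrans g^-1%g).
Proof. exact: mulKg. Qed.

Lemma rtransK g : cancel (rtrans g) (rtrans g^-1%g).
Proof. exact: mulgK. Qed.

Lemma ltrans_continuous g : continuous (ltrans g).
Proof.
move=> h; apply: (continuous_comp (f := fun k => (g, k))
  (g := fun z : G * G => (z.1 * z.2)%g)); last exact: lie_mul_continuous.
by apply: cvg_pair; [exact: cvg_cst | exact: cvg_id].
Qed.

Lemma rtrans_continuous g : continuous (rtrans g).
Proof.
move=> h; apply: (continuous_comp (f := fun k => (k, g))
  (g := fun z : G * G => (z.1 * z.2)%g)); last exact: lie_mul_continuous.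
by apply: cvg_pair; [exact: cvg_id | exact: cvg_cst].
Qed.

(** The case of order 1 of the smoothness of the multiplication, in the
    preferred charts at [g], [h] and [g * h]. *)
Lemma differentiable_mul g h :
  differentiable
    (fun z : 'rV[R]_n * 'rV[R]_n => chart_at (g * h)%g
      (chart_inv (chart_at g) z.1 * chart_inv (chart_at h) z.2)%g)
    (chart_at g g, chart_at h h).
Proof.
have [dg dh] := (chart_at_dom g, chart_at_dom h).
have [+ _] := lie_mul_smooth _ _ _ (chart_at_atlas g) (chart_at_atlas h)
  (chart_at_atlas (g * h)%g) 1%N.
apply; split => /=; [by exists g | by exists h |].
by rewrite !chart_mapK //; exact: chart_at_dom.
Qed.

Lemma differentiable_ltrans g h :
  differentiable (coord_expr (ltrans g) h) (chart_at h h).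
Proof.
have -> : coord_expr (ltrans g) h =
    (fun z : 'rV[R]_n * 'rV[R]_n => chart_at (g * h)%g
      (chart_inv (chart_at g) z.1 * chart_inv (chart_at h) z.2)%g) \o
    (fun x => (chart_at g g, x)).
  by apply/funext => x; rewrite /coord_expr /= (chart_mapK (chart_at_dom g)).
apply: differentiable_comp; last exact: differentiable_mul.
exact: differentiable_pair.
Qed.

Lemma differentiable_rtrans g h :
  differentiable (coord_expr (rtrans h) g) (chart_at g g).
Proof.
have -> : coord_expr (rtrans h) g =
    (fun z : 'rV[R]_n * 'rV[R]_n => chart_at (g * h)%g
      (chart_inv (chart_at g) z.1 * chart_inv (chart_at h) z.2)%g) \o
    (fun x => (x, chart_at h h)).
  by apply/funext => x; rewrite /coord_expr /= (chart_mapK (chart_at_dom h)).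
apply: differentiable_comp; last exact: differentiable_mul.
exact: differentiable_pair.
Qed.

Lemma tangent_ltransK g h (v : 'rV[R]_n) :
  tangent_map (ltrans g^-1%g) (g * h)%g (tangent_map (ltrans g) h v) = v.
Proof.
by apply: (tangent_mapK (ltransK g)); [exact: ltrans_continuous |
  exact: differentiable_ltrans..].
Qed.

Lemma tangent_rtransK g h (v : 'rV[R]_n) :
  tangent_map (rtrans h^-1%g) (g * h)%g (tangent_map (rtrans h) g v) = v.
Proof.
by apply: (tangent_mapK (rtransK h)); [exact: rtrans_continuous |
  exact: differentiable_rtrans..].
Qed.

End Translations.

(** * Transport of a subspace of the dual and of its annihilator *)

Section Transport.
Context (K : fieldType) (V : vectType K).

(** Two inverse pullbacks that map [P] and [Q] into each other restrict to
    bijections between them; the annihilators then correspond under the inverse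
    maps, as [a (T w)] is [TS a] evaluated at [w].  The transposes [TS] and
    [ST] of [T] and [S] are arguments, characterized by their values, so that
    cotangent maps can be supplied for them. *)
Lemma dual_transport (T S : 'End(V)) (TS ST : 'End('Hom(V, K^o)))
    (P Q : {vspace 'Hom(V, K^o)}) (A B : {vspace V}) :
  cancel S T -> cancel T S ->
  (forall a, TS a = (a \o T)%VF) -> (forall a, ST a = (a \o S)%VF) ->
  (forall a, a \in Q -> TS a \in P) -> (forall a, a \in P -> ST a \in Q) ->
  (forall v, v \in A <-> forall a, a \in P -> a v = 0) ->
  (forall v, v \in B <-> forall a, a \in Q -> a v = 0) ->
  [/\ Q = (ST @: P)%VS, B = (T @: A)%VS, \dim Q = \dim P & \dim B = \dim A].
Proof.
move=> SK TK TSE STE QP PQ AP BQ.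
have TSK : cancel TS ST.
  by move=> a; apply/lfunP => v; rewrite STE TSE !comp_lfunE SK.
have STK : cancel ST TS.
  by move=> a; apply/lfunP => v; rewrite TSE STE !comp_lfunE TK.
have eqQ : Q = (ST @: P)%VS.
  apply/vspaceP => a; apply/idP/memv_imgP => [Qa|[b Pb ->]]; last exact: PQ.
  by exists (TS a); rewrite ?TSK //; exact: QP.
have eqB : B = (T @: A)%VS.
  apply/vspaceP => v; apply/idP/memv_imgP => [/BQ Bv|[w /AP Aw ->]].
    exists (S v); last by rewrite SK.
    by apply/AP => a /PQ /Bv; rewrite STE comp_lfunE.
  by apply/BQ => a /QP /Aw; rewrite TSE comp_lfunE.
have ker0 (W : vectType K) (f g : 'End(W)) U : cancel f g ->
    \dim (f @: U) = \dim U.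
  move=> fK; apply: limg_dim_eq; apply/eqP.
  have /lker0P/eqP-> : injective f by exact: can_inj fK.
  by rewrite capv0.
by split; rewrite ?{1}eqQ ?{1}eqB //; [exact: ker0 STK | exact: ker0 TK].
Qed.

End Transport.

(** * Invariance of the characteristic distributions *)

Section MultiplicativeDirac.
Context (R : realType) (n : nat) (G : lieGroupType R n).
Variable D : forall g : G, {vspace pontryagin g}.
Hypothesis hD : dirac_lie_group D.

(** The pairing of [(v, 0)] with [(u, a)] is [a v], so [(v, 0)] is orthogonal to
    [D g] exactly when [v] is killed by all covector components of [D g]. *)
Lemma G0_annihilator g (v : tangent g) :
  v \in G0 D g <-> forall a : cotangent g, a \in P1 D g -> a v = 0.
Proof.
case: hD => [[_ lagr] _]; rewrite mem_G0; split => [/lagr Dv a /mem_P1[u Dua]|Pv].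
  by have := Dv _ Dua; rewrite /pairing /= zero_lfunE addr0.
apply/lagr => -[u a] Dua; rewrite /pairing /= zero_lfunE addr0.
by apply: Pv; apply/mem_P1; exists u.
Qed.

Lemma P1_mul g h (a : cotangent (g * h)%g) : a \in P1 D (g * h)%g ->
  cotangent_map (rtrans h) g a \in P1 D g /\
  cotangent_map (ltrans g) h a \in P1 D h.
Proof.
case: hD => [_ mulD] /mem_P1[v Dva].
have [w [u [Dw Du _]]] := mulD _ _ _ _ Dva.
by split; apply/mem_P1; [exists w | exists u].
Qed.

(** The product is replaced by a point [k] propositionally equal to it, so that
    the lemma applies to [g * 1] and [g^-1 * g]; covectors are taken in the
    common type ['Hom('rV[R]_n, R^o)] underlying all the fibres. *)
Lemma P1_ltrans g h k : (g * h)%g = k ->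
  forall a : 'Hom('rV[R]_n, R^o), a \in (P1 D k : {vspace 'Hom('rV[R]_n, R^o)}) ->
  cotangent_map (ltrans g) h a \in P1 D h.
Proof. by move=> <- a /P1_mul[]. Qed.

Lemma P1_rtrans g h k : (g * h)%g = k ->
  forall a : 'Hom('rV[R]_n, R^o), a \in (P1 D k : {vspace 'Hom('rV[R]_n, R^o)}) ->
  cotangent_map (rtrans h) g a \in P1 D g.
Proof. by move=> <- a /P1_mul[]. Qed.

Lemma left_transport g :
  [/\ P1 D g = left_codistribution (P1 D 1%g) g,
      G0 D g = left_distribution (G0 D 1%g) g,
      \dim (P1 D g) = \dim (P1 D 1%g) & \dim (G0 D g) = \dim (G0 D 1%g)].
Proof.
apply: (@dual_transport _ 'rV[R]_n (tangent_map (ltrans g) 1%g)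
  (tangent_map (ltrans g^-1%g) g) (cotangent_map (ltrans g) 1%g)
  (cotangent_map (ltrans g^-1%g) g) (P1 D 1%g) (P1 D g) (G0 D 1%g) (G0 D g)).
- by move=> v; have := tangent_ltransK g^-1%g g v; rewrite invgK mulVg.
- by move=> v; have := tangent_ltransK g 1%g v; rewrite mulg1.
- exact: cotangent_mapE.
- exact: cotangent_mapE.
- exact: (P1_ltrans (mulg1 g)).
- exact: (P1_ltrans (mulVg g)).
- exact: G0_annihilator.
- exact: G0_annihilator.
Qed.

Lemma right_transport g :
  [/\ P1 D g = right_codistribution (P1 D 1%g) g,
      G0 D g = right_distribution (G0 D 1%g) g,
      \dim (P1 D g) = \dim (P1 D 1%g) & \dim (G0 D g) = \dim (G0 D 1%g)].
Proof.
apply: (@dual_transport _ 'rV[R]_n (tangent_map (rtrans g) 1%g)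
  (tangent_map (rtrans g^-1%g) g) (cotangent_map (rtrans g) 1%g)
  (cotangent_map (rtrans g^-1%g) g) (P1 D 1%g) (P1 D g) (G0 D 1%g) (G0 D g)).
- by move=> v; have := tangent_rtransK g g^-1%g v; rewrite invgK mulgV.
- by move=> v; have := tangent_rtransK 1%g g v; rewrite mul1g.
- exact: cotangent_mapE.
- exact: cotangent_mapE.
- exact: (P1_rtrans (mul1g g)).
- exact: (P1_rtrans (mulgV g)).
- exact: G0_annihilator.
- exact: G0_annihilator.
Qed.

End MultiplicativeDirac.

Theorem proposition3p4 (R : realType) (n : nat) (G : lieGroupType R n)
    (D : forall g : G, {vspace pontryagin g}) (hD : dirac_lie_group D) :
  (constant_rank (P1 D) /\
   (forall g : G, P1 D g = left_codistribution (P1 D 1%g) g) /\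
   (forall g : G, P1 D g = right_codistribution (P1 D 1%g) g)) /\
  (constant_rank (G0 D) /\
   (forall g : G, G0 D g = left_distribution (G0 D 1%g) g) /\
   (forall g : G, G0 D g = right_distribution (G0 D 1%g) g)).
Proof.
split; split; [exists (\dim (P1 D 1%g)) | split | exists (\dim (G0 D 1%g)) | split];
  by move=> g; have [] := left_transport hD g; have [] := right_transport hD g.
Qed.
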